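(* Let $n,m,M$ be positive integers, let $(A_i,B_i)\in\mathbb{R}^{n\times n}\times\mathbb{R}^{n\times m}$ for $i\in\langle M\rangle$, and let $\mathcal{G}=(S,E)$ be a complete and deterministic graph on $\langle M\rangle$. Suppose there exist positive definite matrices $\{P_s\}_{s\in S}\subset\mathbb{S}_+^{n\times n}$ and matrices $\{K_{s,j}\}_{(s,j)\in S\times\langle M\rangle}\subset\mathbb{R}^{m\times n}$ such that $$(A_i+B_iK_{a,i})^\top P_b(A_i+B_iK_{a,i})-P_a\prec 0\qquad\text{for all } e=(a,b,i)\in E.$$ Let $\gamma:\mathbb{R}^n\to S$ be any function satisfying $$\gamma(x)\in\operatorname*{argmin}_{s\in S}\{x^\top P_s x\}\qquad\text{for all }x\in\mathbb{R}^n$$ and for which the maps $\Phi_i:\mathbb{R}^n\to\mathbb{R}^m$, $\Phi_i(x):=K_{\gamma(x),i}\,x$, $i\in\langle M\rangle$, are piecewise linear. Then $\Phi_1,\dots,\Phi_M$ exponentially stabilize the switched system $x(k+1)=A_{\sigma(k)}x(k)+B_{\sigma(k)}u(k)$ in the mode-dependent sense, that is, the closed-loop switched system $$x(k+1)=A_{\sigma(k)}x(k)+B_{\sigma(k)}\Phi_{\sigma(k)}(x(k)),\qquad k\in\mathbb{N},\ \sigma:\mathbb{N}\to\langle M\rangle,$$ is uniformly exponentially stable.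
   Context: Notation: $\mathbb{N}$ includes $0$; $\langle M\rangle:=\{1,\dots,M\}$; $\mathbb{S}_+^{n\times n}$ is the set of symmetric positive definite real $n\times n$ matrices; for symmetric matrices, $X\prec 0$ means negative definite. Graphs: a (labeled, directed) graph $\mathcal{G}=(S,E)$ on $\langle M\rangle$ consists of a finite set of nodes $S$ and a set of labeled edges $E\subset S\times S\times\langle M\rangle$. It is complete if for all $a\in S$ and all $i\in\langle M\rangle$ there exists at least one $b\in S$ with $(a,b,i)\in E$. It is deterministic if for all $a\in S$ and all $i\in\langle M\rangle$ there exists at most one $b\in S$ with $(a,b,i)\in E$. Piecewise linear: a function $\Psi:\mathbb{R}^n\to\mathbb{R}^m$ is piecewise linear if (i) $\Psi(\lambda x)=\lambda\Psi(x)$ for all $\lambda\in\mathbb{R}_+$, $x\in\mathbb{R}^n$; and (ii) for some positive integer $c$ there exist closed convex cones $C_1,\dots,C_c\subset\mathbb{R}^n$ and linear maps $\Xi_1,\dots,\Xi_c:\mathbb{R}^n\to\mathbb{R}^m$ such that $\bigcup_{j}C_j=\mathbb{R}^n$, $\mathrm{Int}(C_i)\cap\mathrm{Int}(C_j)=\emptyset$ for $i\neq j$, and $\Psi(x)=\Xi_j(x)$ for all $x\in\mathrm{Int}(C_j)$ and all $j$. (Continuity is not required.) Stability: given $f_1,\dots,f_M:\mathbb{R}^n\to\mathbb{R}^n$ with $f_j(0)=0$, the switched system $x(k+1)=f_{\sigma(k)}(x(k))$, $x(0)=x_0$, is uniformly exponentially stable (UES) if there exist $C>0$ and $\mu\in[0,1)$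 such that for every switching signal $\sigma:\mathbb{N}\to\langle M\rangle$ and every $x_0\in\mathbb{R}^n$ the solution satisfies $|x(k)|\le C\mu^k|x_0|$ for all $k\in\mathbb{N}$. Here $f_i(x)=A_ix+B_i\Phi_i(x)$. *)

(* Defs.v *)
From HB Require Import structures.
From mathcomp Require Import all_boot all_order all_algebra.
From mathcomp Require Import all_classical all_reals all_analysis.

Set Implicit Arguments.
Unset Strict Implicit.
Unset Printing Implicit Defensive.

Import Order.TTheory GRing.Theory Num.Theory.
Import numFieldNormedType.Exports.

Local Open Scope classical_set_scope.
Local Open Scope ring_scope.

(* A labeled directed graph on the labels 'I_M is given by its finType of nodes
   S and its set of edges E, with (a, b, i) an edge from a to b labeled i. *)

Definition complete_graph (M : nat) (S : finType) (E : {set S * S * 'I_M}) :=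
  forall (a : S) (i : 'I_M), exists b : S, (a, b, i) \in E.

Definition deterministic_graph (M : nat) (S : finType)
    (E : {set S * S * 'I_M}) :=
  forall (a : S) (i : 'I_M) (b b' : S),
    (a, b, i) \in E -> (a, b', i) \in E -> b = b'.

Definition qform (R : realType) (n : nat) (X : 'M[R]_n) (x : 'cV[R]_n) : R :=
  (x^T *m X *m x) 0 0.

Definition positive_definite (R : realType) (n : nat) (X : 'M[R]_n) :=
  X \is symmetricmx /\ forall x : 'cV[R]_n, x != 0 -> 0 < qform X x.

Definition negative_definite (R : realType) (n : nat) (X : 'M[R]_n) :=
  X \is symmetricmx /\ forall x : 'cV[R]_n, x != 0 -> qform X x < 0.

Definition argmin (R : realType) (T : Type) (f : T -> R) : set T :=
  [set s | forall t : T, f s <= f t].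

Definition convex_cone (R : realType) (n : nat) (C : set 'cV[R]_n) :=
  convex_set (C : set (convex_lmodType 'cV[R]_n)) /\
  forall (l : R) (x : 'cV[R]_n), 0 <= l -> C x -> C (l *: x).

(* No continuity is required: the values of Psi on the boundaries of the cones
   are constrained only by positive homogeneity. *)
Definition piecewise_linear (R : realType) (n m : nat)
    (Psi : 'cV[R]_n -> 'cV[R]_m) :=
  (forall (l : R) (x : 'cV[R]_n), 0 <= l -> Psi (l *: x) = l *: Psi x) /\
  exists (c : nat) (C : 'I_c -> set 'cV[R]_n)
      (Xi : 'I_c -> {linear 'cV[R]_n -> 'cV[R]_m}),
    [/\ (0 < c)%N,
        forall j, closed (C j) /\ convex_cone (C j),
        \bigcup_j C j = setT,
        forall i j, i != j -> (C i)° `&` (C j)° = set0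
      & forall j x, (C j)° x -> Psi x = Xi j x].

(* The library norm on matrices is the sup norm, hence this definition. *)
Definition enorm (R : realType) (n : nat) (x : 'cV[R]_n) : R :=
  Num.sqrt (\sum_(i < n) x i 0 ^+ 2).

Definition is_solution (R : realType) (n M : nat)
    (f : 'I_M -> 'cV[R]_n -> 'cV[R]_n) (sigma : nat -> 'I_M)
    (x0 : 'cV[R]_n) (x : nat -> 'cV[R]_n) :=
  x 0%N = x0 /\ forall k : nat, x k.+1 = f (sigma k) (x k).

Definition uniformly_exponentially_stable (R : realType) (n M : nat)
    (f : 'I_M -> 'cV[R]_n -> 'cV[R]_n) :=
  exists C mu : R, [/\ 0 < C, 0 <= mu < 1 &
    forall (sigma : nat -> 'I_M) (x0 : 'cV[R]_n) (x : nat -> 'cV[R]_n),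
      is_solution f sigma x0 x ->
      forall k : nat, enorm (x k) <= C * mu ^+ k * enorm x0].

(* Main.v *)
Require Import Defs.
From HB Require Import structures.
From mathcomp Require Import all_boot all_order all_algebra.
From mathcomp Require Import all_classical all_reals all_analysis.
From mathcomp Require Import ring lra.

Set Implicit Arguments.
Unset Strict Implicit.
Unset Printing Implicit Defensive.

Import Order.TTheory GRing.Theory Num.Theory.
Import numFieldNormedType.Exports.

Local Open Scope ring_scope.

(* V x := min_s qform (P s) x is a common Lyapunov function: along the edge
   (gamma x, b, i), the value V of the successor of x is at most that of
   qform (P b), which is smaller than V x = qform (P (gamma x)) x by at least a
   multiple of |x|^2, uniformly over the finitely many edges. As V is comparable
   to |x|^2, it decays geometrically. *)

Lemma symmetricmxP (R : realType) (n : nat) (X : 'M[R]_n) :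
  reflect (X^T = X) (X \is symmetricmx).
Proof.
(* [symmetricmx] is a sesquilinear symmetry condition with trivial sign and the identity as
   conjugation. *)
have <- : (X^T ^ (@id R))%sesqui = X^T by apply/matrixP => i j; rewrite !mxE.
apply: (iffP (is_hermitianmxP _ _ _)); rewrite expr0 scale1r //.
Qed.

Lemma negative_definite_opp (R : realType) (n : nat) (X : 'M[R]_n) :
  negative_definite X -> positive_definite (- X).
Proof.
move=> [/symmetricmxP Xsym Xneg]; split.
  by apply/symmetricmxP; rewrite linearN /= Xsym.
by move=> x /Xneg; rewrite /qform mulmxN mulNmx [X in _ -> 0 < X]mxE oppr_gt0.
Qed.

Lemma qform_linear_comb (R : realType) (n : nat) (X : 'M[R]_n) (a b : R)
    (x y : 'cV[R]_n) : X \is symmetricmx ->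
  qform X (a *: x - b *: y) =
    a ^+ 2 * qform X x - 2 * a * b * (x^T *m X *m y) 0 0 + b ^+ 2 * qform X y.
Proof.
move=> /symmetricmxP Xsym.
(* A 1-by-1 matrix equals its transpose. *)
have yxE : (y^T *m X *m x) 0 0 = (x^T *m X *m y) 0 0.
  transitivity ((x^T *m X *m y)^T 0 0); last by rewrite mxE.
  by rewrite !trmx_mul trmxK Xsym mulmxA.
rewrite /qform [_^T]linearB /= ![(_ *: _)^T]linearZ /= !mulmxBl !mulmxBr.
rewrite -!scalemxAl -!scalemxAr.
rewrite !mxE in yxE *.
by rewrite yxE; ring.
Qed.

(** With [s] the inner product of [x] and [y], the form at [qform X y *: x - s *: y] is [qform X y *
    (qform X x * qform X y - s ^+ 2)]; it is nonnegative, and the factor [qform X y] is positive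
    unless [y = 0]. *)
Lemma qform_cauchy_schwarz (R : realType) (n : nat) (X : 'M[R]_n)
    (x y : 'cV[R]_n) : positive_definite X ->
  (x^T *m X *m y) 0 0 ^+ 2 <= qform X x * qform X y.
Proof.
move=> [Xsym Xpos].
have Xge0 z : 0 <= qform X z.
  have [->|/Xpos/ltW //] := eqVneq z 0.
  by rewrite /qform mulmx0 mxE.
have [->|/Xpos qy] := eqVneq y 0.
  by rewrite /qform !mulmx0 mxE expr0n mulr0.
have := Xge0 (qform X y *: x - (x^T *m X *m y) 0 0 *: y).
rewrite qform_linear_comb // => h.
by rewrite -subr_ge0 -(pmulr_rge0 _ qy); move: h; congr (0 <= _); ring.
Qed.

(** A nonzero row [r] with [r *m X = 0] would give a nonzero vector [r^T] at which the form
    vanishes. *)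
Lemma positive_definite_unitmx (R : realType) (n : nat) (X : 'M[R]_n) :
  positive_definite X -> X \in unitmx.
Proof.
move=> [_ Xpos]; rewrite -row_free_unit -kermx_eq0.
apply/eqP/row_matrixP => i; rewrite row0; apply/eqP/negPn/negP => ri0.
have : (row i (kermx X))^T != 0 by rewrite trmx_eq0.
by move=> /Xpos; rewrite /qform trmxK -row_mul mulmx_ker row0 mul0mx mxE ltxx.
Qed.

Lemma enorm_sqr (R : realType) (n : nat) (x : 'cV[R]_n) :
  enorm x ^+ 2 = \sum_(i < n) x i 0 ^+ 2.
Proof. by rewrite sqr_sqrtr // sumr_ge0 // => i _; exact: sqr_ge0. Qed.

(* With y := X^-1 e_i, the i-th coordinate of x is the X-inner product of x and
   y, so Cauchy-Schwarz bounds its square by qform X x * qform X y. *)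
Lemma enorm_le_qform (R : realType) (n : nat) (X : 'M[R]_n) :
  positive_definite X ->
  exists c : R, forall x : 'cV[R]_n, enorm x ^+ 2 <= c * qform X x.
Proof.
move=> Xpd; have Xunit := positive_definite_unitmx Xpd.
pose y (i : 'I_n) : 'cV[R]_n := invmx X *m delta_mx i 0.
exists (\sum_(i < n) qform X (y i)) => x.
rewrite enorm_sqr mulr_suml ler_sum // => i _.
rewrite mulrC; apply: le_trans (qform_cauchy_schwarz x (y i) Xpd).
by rewrite mulmxA mulmxK // -colE !mxE.
Qed.

(** Each product of two coordinates is at most [enorm x ^+ 2] in absolute value, so the sum of the
    absolute values of the entries of [X] serves as constant. *)
Lemma qform_le_enorm (R : realType) (n : nat) (X : 'M[R]_n) :
  exists c : R, forall x : 'cV[R]_n, qform X x <= c * enorm x ^+ 2.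
Proof.
exists (\sum_(j < n) \sum_(i < n) `|X i j|) => x.
have coord_le k : x k 0 ^+ 2 <= enorm x ^+ 2.
  rewrite enorm_sqr (bigD1 k) //= lerDl sumr_ge0 // => i _; exact: sqr_ge0.
rewrite /qform mxE mulr_suml; apply: ler_sum => j _.
rewrite mxE !mulr_suml; apply: ler_sum => i _; rewrite !mxE.
apply: le_trans (ler_norm _) _.
rewrite [x i 0 * _]mulrC -mulrA normrM ler_wpM2l // ler_norml.
by have := coord_le i; have := coord_le j; nra.
Qed.

(** Since [g] is nonnegative, every constant may be enlarged to one plus the sum of all their
    absolute values. The summand 1 gives [1 <= c], which later ensures [0 <= rho]. *)
Lemma uniform_bound (R : realType) (T : finType) (U : Type) (f g : T -> U -> R) :
  (forall t u, 0 <= g t u) ->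
  (forall t, exists c : R, forall u, f t u <= c * g t u) ->
  exists2 c : R, 1 <= c & forall t u, f t u <= c * g t u.
Proof.
move=> g_ge0 /choice[c fg]; exists (1 + \sum_t `|c t|) => [|t u].
  by rewrite lerDl sumr_ge0.
apply: le_trans (fg t u) (ler_wpM2r (g_ge0 t u) _).
rewrite (bigD1 t) //= addrCA (le_trans (ler_norm _)) // lerDl addr_ge0 //.
by rewrite sumr_ge0.
Qed.

Theorem proposition4 (R : realType) (n m M : nat)
    (n_gt0 : (0 < n)%N) (m_gt0 : (0 < m)%N) (M_gt0 : (0 < M)%N)
    (A : 'I_M -> 'M[R]_n) (B : 'I_M -> 'M[R]_(n, m))
    (S : finType) (E : {set S * S * 'I_M})
    (E_complete : complete_graph E) (E_deterministic : deterministic_graph E)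
    (P : S -> 'M[R]_n) (K : S -> 'I_M -> 'M[R]_(m, n))
    (P_posdef : forall s : S, positive_definite (P s))
    (P_decr : forall (a b : S) (i : 'I_M), (a, b, i) \in E ->
      negative_definite
        ((A i + B i *m K a i)^T *m P b *m (A i + B i *m K a i) - P a))
    (gamma : 'cV[R]_n -> S)
    (gamma_argmin : forall x : 'cV[R]_n,
      argmin (fun s : S => qform (P s) x) (gamma x))
    (Phi : 'I_M -> 'cV[R]_n -> 'cV[R]_m)
    (Phi_def : forall (i : 'I_M) (x : 'cV[R]_n), Phi i x = K (gamma x) i *m x)
    (Phi_pwl : forall i : 'I_M, piecewise_linear (Phi i)) :
  uniformly_exponentially_stable
    (fun (i : 'I_M) (x : 'cV[R]_n) => A i *m x + B i *m Phi i x).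
Proof.
have Pge0 s x : 0 <= qform (P s) x.
  have [->|x0] := eqVneq x 0; first by rewrite /qform mulmx0 mxE.
  by case: (P_posdef s) => _ /(_ x x0)/ltW.
have [c1 c1_ge1 lower] := uniform_bound Pge0
  (fun s => enorm_le_qform (P_posdef s)).
have [c2 c2_ge1 upper] := uniform_bound (fun s x => sqr_ge0 (enorm x))
  (fun s => qform_le_enorm (P s)).
pose F a i := (A i + B i *m K a i : 'M[R]_n).
(* The decrease along an edge, indexed by the finite type of edges so that [uniform_bound]
   applies. *)
pose D (e : {e | e \in E}) x :=
  let: (a, b, i) := val e in qform (P a) x - qform (P b) (F a i *m x).
have [] : exists2 c : R, 1 <= c & forall e x, enorm x ^+ 2 <= c * D e x.
  have DE a b i (ein : (a, b, i) \in E) :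
    D (exist _ (a, b, i) ein) =1
      qform (- ((F a i)^T *m P b *m F a i - P a)).
    move=> x; rewrite /D /= /qform trmx_mul opprB mulmxBr mulmxBl !mulmxA.
    by rewrite [RHS]mxE [X in _ = _ + X]mxE.
  have pd a b i (ein : (a, b, i) \in E) :
    positive_definite (- ((F a i)^T *m P b *m F a i - P a)).
    exact: negative_definite_opp (P_decr _ _ _ ein).
  apply: uniform_bound => [[[[a b] i] ein] x|[[[a b] i] ein]].
    have [->|x0] := eqVneq x 0; first by rewrite DE /qform mulmx0 mxE.
    by rewrite DE; case: (pd _ _ _ ein) => _ /(_ x x0)/ltW.
  have [c hc] := enorm_le_qform (pd _ _ _ ein).
  by exists c => x; rewrite DE.
move=> c3 c3_ge1 decr.
pose V x := qform (P (gamma x)) x.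
(* The bounds [V x <= c2 * enorm x ^+ 2] and [enorm x ^+ 2 <= c3 * D e x] show that [V] drops by at
   least [V x / (c3 * c2)]. *)
pose rho : R := 1 - (c3 * c2)^-1.
have c32 : 1 <= c3 * c2 by nra.
have rho01 : 0 <= rho < 1.
  by rewrite subr_ge0 invf_le1 ?(lt_le_trans ltr01) // c32 ltrBlDr ltrDl
             invr_gt0 (lt_le_trans ltr01).
have [rho_ge0 rho_lt1] := andP rho01.
have Vstep i x : V (A i *m x + B i *m Phi i x) <= rho * V x.
  have [b eb] := E_complete (gamma x) i.
  rewrite Phi_def mulmxA -mulmxDl -/(F (gamma x) i).
  (* Minimality is used at the successor of [x], with [b] as competitor. *)
  apply: le_trans (gamma_argmin _ b) _.
  have := decr (exist _ (gamma x, b, i) eb) x; rewrite /D /= -/(V x).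
  have := upper (gamma x) x; rewrite -/(V x) => h1 h2.
  rewrite /rho mulrBl mul1r lerBrDr -lerBrDl mulrC.
  rewrite ler_pdivrMr ?(lt_le_trans ltr01) //.
  by nra.
(* The estimate on [V] controls squared norms by [c1 * c2 * rho ^+ k], hence the square roots. *)
exists (Num.sqrt (c1 * c2)), (Num.sqrt rho); split.
- by rewrite sqrtr_gt0; nra.
- by rewrite sqrtr_ge0 -[ltRHS]sqrtr1 ltr_sqrt.
move=> sigma x0 x [x_init x_step] k.
have Vk : V (x k) <= rho ^+ k * V (x 0%N).
  elim: k => [|k IHk]; first by rewrite mul1r.
  rewrite x_step exprS -mulrA.
  by apply: le_trans (Vstep _ _) _; exact: ler_wpM2l.
rewrite -(@ler_pXn2r _ 2) ?nnegrE ?mulr_ge0 ?exprn_ge0 ?sqrtr_ge0 //.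
rewrite !exprMn -exprM mulnC exprM.
rewrite (sqr_sqrtr rho_ge0) (@sqr_sqrtr _ (c1 * c2)); last by nra.
apply: le_trans (lower (gamma (x k)) (x k)) _.
rewrite -!mulrA; apply: ler_wpM2l; first by lra.
apply: le_trans Vk _; rewrite mulrCA ler_wpM2l ?exprn_ge0 //.
by rewrite -x_init; exact: upper.
Qed.
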